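(* Let $F$ be a field and let $\mathbf{n}$ be a supernatural number. Then $\operatorname{M}_{\mathbf{n}}(F)$ can be identified (is isomorphic as an $F$-algebra) with the subalgebra of $\operatorname{M}_{\text{rc-fin}}(F)$ composed of the $\mathbf{n}$-recurrent matrices.
   Context: A supernatural number is a formal product $\prod_p p^{\alpha_p}$ over the primes, with $\alpha_p\in\mathbb{N}\cup\{\infty\}$ ($0$ allowed). The supernatural matrix algebra $\operatorname{M}_{\mathbf{n}}(F)$ is the direct limit of the matrix algebras $\operatorname{M}_n(F)$ over the natural divisors $n$ of $\mathbf{n}$, with the maps $\operatorname{M}_m(F)\to\operatorname{M}_n(F)$, $x\mapsto x\otimes 1=\operatorname{diag}(x,\dots,x)$, whenever $m\mid n$. $\operatorname{M}_{\text{rc-fin}}(F)$ is the algebra of infinite matrices over $F$, with rows and columns indexed by $\{0,1,2,\dots\}$, in which every row and every column has finitely many nonzero entries. A matrix $x\in\operatorname{M}_{\text{rc-fin}}(F)$ is $\mathbf{n}$-recurrent if there are a natural divisor $n\mid\mathbf{n}$ and a matrix $a\in\operatorname{M}_n(F)$ such that $x=a\oplus a\oplus\cdots$ (block diagonal with infinitely many copies of $a$). *)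

(* Defs.v *)
From HB Require Import structures.
From mathcomp Require Import all_boot all_order all_algebra.
From mathcomp Require Import boolp classical_sets functions cardinality fsbigop.

Set Implicit Arguments.
Unset Strict Implicit.
Unset Printing Implicit Defensive.

Import GRing.Theory.
Local Open Scope quotient_scope.
Local Open Scope ring_scope.

Record dirsys (F : fieldType) := DirSys {
  ds_idx : choiceType;
  ds_le : rel ds_idx;
  ds_refl : reflexive ds_le;
  ds_trans : transitive ds_le;
  ds_idx0 : ds_idx;
  ds_directed : forall i j, exists k, ds_le i k && ds_le j k;
  ds_alg : ds_idx -> algType F;
  ds_map : forall i j, ds_le i j -> {lrmorphism ds_alg i -> ds_alg j};
  ds_map_id : forall i (h : ds_le i i) x, ds_map h x = x;
  ds_map_comp : forall i j k (hij : ds_le i j) (hjk : ds_le j k)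
    (hik : ds_le i k) x, ds_map hjk (ds_map hij x) = ds_map hik x
}.

Section DirLim.
Variables (F : fieldType) (D : dirsys F).
Local Notation I := (ds_idx D).
Local Notation A := (@ds_alg F D).
Local Notation le := (@ds_le F D).
Local Notation T := {i : I & A i}.

Definition dl_eq (u v : T) : bool :=
  `[< exists k (hu : le (tag u) k) (hv : le (tag v) k),
        ds_map hu (tagged u) = ds_map hv (tagged v) >].

Lemma dl_eq_refl : reflexive dl_eq.
Proof.
move=> u; apply/asboolP.
by exists (tag u), (ds_refl _), (ds_refl _).
Qed.

Lemma dl_eq_sym : symmetric dl_eq.
Proof.
suff S u v : dl_eq u v -> dl_eq v u by move=> u v; apply/idP/idP; exact: S.
by move/asboolP=> [k [hu [hv e]]]; apply/asboolP; exists k, hv, hu.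
Qed.

Lemma dl_eq_trans : transitive dl_eq.
Proof.
move=> v u w /asboolP[k [hu [hv e]]] /asboolP[l [hv' [hw e']]]; apply/asboolP.
have [m /andP[hk hl]] := ds_directed k l.
exists m, (ds_trans hu hk), (ds_trans hw hl).
rewrite -(ds_map_comp hu hk) e -(ds_map_comp hw hl) -e'.
by rewrite (ds_map_comp _ _ (ds_trans hv hk)) (ds_map_comp _ _ (ds_trans hv hk)).
Qed.

Canonical dl_equiv := EquivRel dl_eq dl_eq_refl dl_eq_sym dl_eq_trans.

Definition dirlim := {eq_quot dl_equiv}.
HB.instance Definition _ := EqQuotient.on dirlim.
HB.instance Definition _ := Choice.on dirlim.

Definition dl_in i (x : A i) : dirlim := \pi_dirlim (Tagged A x).

Lemma dl_inP i (x : A i) j (y : A j) :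
  dl_in x = dl_in y <->
  exists k (hi : le i k) (hj : le j k), ds_map hi x = ds_map hj y.
Proof.
split; first by move/eqmodP => /asboolP.
by move=> H; apply/eqmodP; apply/asboolP.
Qed.

Lemma dl_in_map i j (h : le i j) x : dl_in (ds_map h x) = dl_in x.
Proof.
by apply/dl_inP; exists j, (ds_refl j), h; rewrite ds_map_id.
Qed.

Lemma dl_repr (u : dirlim) : u = dl_in (tagged (repr u)).
Proof. by rewrite /dl_in -[LHS]reprK; case: (repr u). Qed.

Definition dl_ub i j : I := xchoose (ds_directed i j).
Lemma dl_ubl i j : le i (dl_ub i j).
Proof. by have /andP[] := xchooseP (ds_directed i j). Qed.
Lemma dl_ubr i j : le j (dl_ub i j).
Proof. by have /andP[] := xchooseP (ds_directed i j). Qed.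

Definition dl_op2 (op : forall k, A k -> A k -> A k) (u v : dirlim) : dirlim :=
  dl_in (op _ (ds_map (dl_ubl (tag (repr u)) (tag (repr v))) (tagged (repr u)))
              (ds_map (dl_ubr (tag (repr u)) (tag (repr v))) (tagged (repr v)))).

Definition dl_op1 (op : forall k, A k -> A k) (u : dirlim) : dirlim :=
  dl_in (op _ (tagged (repr u))).

Lemma dl_op2E (op : forall k, A k -> A k -> A k) i (x y : A i) :
  (forall i j (h : le i j), {morph ds_map h : x y / op _ x y}) ->
  dl_op2 op (dl_in x) (dl_in y) = dl_in (op _ x y).
Proof.
move=> opM; rewrite /dl_op2.
move: (dl_repr (dl_in x)) (dl_repr (dl_in y)).
set u := repr (dl_in x); set v := repr (dl_in y).
move=> /dl_inP[k [hi [hu eu]]] /dl_inP[l [hi' [hv ev]]].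
set m := dl_ub _ _.
have [n /andP[hkn hln]] := ds_directed k l.
have [p /andP[hnp hmp]] := ds_directed n m.
apply/dl_inP; exists p, hmp, (ds_trans hi (ds_trans hkn hnp)); rewrite !opM.
have hkp := ds_trans hkn hnp; have hlp := ds_trans hln hnp.
congr (op _ _ _).
  rewrite -(ds_map_comp hi hkp) eu.
  by rewrite !(ds_map_comp _ _ (ds_trans hu hkp)).
rewrite -(ds_map_comp hi' hlp) ev.
by rewrite !(ds_map_comp _ _ (ds_trans hv hlp)).
Qed.

Lemma dl_op1E (op : forall k, A k -> A k) i (x : A i) :
  (forall i j (h : le i j), {morph ds_map h : x / op _ x}) ->
  dl_op1 op (dl_in x) = dl_in (op _ x).
Proof.
move=> opM; rewrite /dl_op1; move: (dl_repr (dl_in x)).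
set u := repr (dl_in x) => /dl_inP[k [hi [hu eu]]].
by apply/dl_inP; exists k, hu, hi; rewrite !opM eu.
Qed.

Definition dl_add := dl_op2 (fun k => +%R).
Definition dl_mul := dl_op2 (fun k => *%R).
Definition dl_opp := dl_op1 (fun k => -%R).
Definition dl_scale (c : F) := dl_op1 (fun k => *:%R c).
Definition dl_zero := dl_in (0 : A (ds_idx0 D)).
Definition dl_one := dl_in (1 : A (ds_idx0 D)).

Lemma dl_addE i (x y : A i) : dl_add (dl_in x) (dl_in y) = dl_in (x + y).
Proof. by apply: dl_op2E => j k h a b; rewrite rmorphD. Qed.
Lemma dl_mulE i (x y : A i) : dl_mul (dl_in x) (dl_in y) = dl_in (x * y).
Proof. by apply: dl_op2E => j k h a b; rewrite rmorphM. Qed.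
Lemma dl_oppE i (x : A i) : dl_opp (dl_in x) = dl_in (- x).
Proof. by apply: dl_op1E => j k h a; rewrite rmorphN. Qed.
Lemma dl_scaleE c i (x : A i) : dl_scale c (dl_in x) = dl_in (c *: x).
Proof. by apply: dl_op1E => j k h a; rewrite linearZ. Qed.
Lemma dl_zeroE i : dl_zero = dl_in (0 : A i).
Proof.
have [k /andP[h h']] := ds_directed (ds_idx0 D) i.
by apply/dl_inP; exists k, h, h'; rewrite !raddf0.
Qed.
Lemma dl_oneE i : dl_one = dl_in (1 : A i).
Proof.
have [k /andP[h h']] := ds_directed (ds_idx0 D) i.
by apply/dl_inP; exists k, h, h'; rewrite !rmorph1.
Qed.
Definition dl_E := (dl_addE, dl_mulE, dl_oppE, dl_scaleE).

Lemma dl_ind1 (P : dirlim -> Prop) : (forall i (x : A i), P (dl_in x)) ->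
  forall u, P u.
Proof. by move=> H u; rewrite (dl_repr u). Qed.

Lemma dl_ind2 (P : dirlim -> dirlim -> Prop) :
  (forall i (x y : A i), P (dl_in x) (dl_in y)) -> forall u v, P u v.
Proof.
move=> H; apply: (@dl_ind1 (fun u => forall v, P u v)) => i x.
apply: dl_ind1 => j y.
have [k /andP[h h']] := ds_directed i j.
by rewrite -(dl_in_map h) -(dl_in_map h').
Qed.

Lemma dl_ind3 (P : dirlim -> dirlim -> dirlim -> Prop) :
  (forall i (x y z : A i), P (dl_in x) (dl_in y) (dl_in z)) ->
  forall u v w, P u v w.
Proof.
move=> H; apply: (@dl_ind2 (fun u v => forall w, P u v w)) => i x y.
apply: dl_ind1 => j z.
have [k /andP[h h']] := ds_directed i j.
by rewrite -(dl_in_map h x) -(dl_in_map h y) -(dl_in_map h').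
Qed.

Lemma dl_addA : associative dl_add.
Proof. by apply: dl_ind3 => i x y z; rewrite !dl_E addrA. Qed.
Lemma dl_addC : commutative dl_add.
Proof. by apply: dl_ind2 => i x y; rewrite !dl_E addrC. Qed.
Lemma dl_add0 : left_id dl_zero dl_add.
Proof. by apply: dl_ind1 => i x; rewrite (dl_zeroE i) !dl_E add0r. Qed.
Lemma dl_addN : left_inverse dl_zero dl_opp dl_add.
Proof. by apply: dl_ind1 => i x; rewrite (dl_zeroE i) !dl_E addNr. Qed.
HB.instance Definition _ :=
  GRing.isZmodule.Build dirlim dl_addA dl_addC dl_add0 dl_addN.

Lemma dl_mulA : associative dl_mul.
Proof. by apply: dl_ind3 => i x y z; rewrite !dl_E mulrA. Qed.
Lemma dl_mul1 : left_id dl_one dl_mul.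
Proof. by apply: dl_ind1 => i x; rewrite (dl_oneE i) !dl_E mul1r. Qed.
Lemma dl_mulr1 : right_id dl_one dl_mul.
Proof. by apply: dl_ind1 => i x; rewrite (dl_oneE i) !dl_E mulr1. Qed.
Lemma dl_mulDl : left_distributive dl_mul dl_add.
Proof. by apply: dl_ind3 => i x y z; rewrite !dl_E mulrDl. Qed.
Lemma dl_mulDr : right_distributive dl_mul dl_add.
Proof. by apply: dl_ind3 => i x y z; rewrite !dl_E mulrDr. Qed.
Lemma dl_one_neq0 : dl_one != 0.
Proof.
apply/eqP => /dl_inP[k [h [h']]]; rewrite raddf0 rmorph1.
by move/eqP; rewrite oner_eq0.
Qed.
HB.instance Definition _ := GRing.Zmodule_isNzRing.Build dirlim
  dl_mulA dl_mul1 dl_mulr1 dl_mulDl dl_mulDr dl_one_neq0.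

Lemma dl_scaleA a b v : dl_scale a (dl_scale b v) = dl_scale (a * b) v.
Proof. by move: v; apply: dl_ind1 => i x; rewrite !dl_E scalerA. Qed.
Lemma dl_scale1 : left_id 1 dl_scale.
Proof. by apply: dl_ind1 => i x; rewrite !dl_E scale1r. Qed.
Lemma dl_scaleDr : right_distributive dl_scale +%R.
Proof.
move=> c; apply: dl_ind2 => i x y.
by rewrite /GRing.add /= !dl_E scalerDr.
Qed.
Lemma dl_scaleDl v : {morph dl_scale^~ v : a b / a + b}.
Proof.
move=> a b; move: v; apply: dl_ind1 => i x.
by rewrite [RHS]/GRing.add /= !dl_E scalerDl.
Qed.
HB.instance Definition _ := GRing.Zmodule_isLmodule.Build F dirlim
  dl_scaleA dl_scale1 dl_scaleDr dl_scaleDl.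

Lemma dl_scaleAl (c : F) (u v : dirlim) : c *: (u * v) = (c *: u) * v.
Proof.
rewrite /GRing.scale /GRing.mul /=; move: u v; apply: dl_ind2 => i x y.
by rewrite !dl_E scalerAl.
Qed.
HB.instance Definition _ := GRing.Lmodule_isLalgebra.Build F dirlim dl_scaleAl.

Lemma dl_scaleAr (c : F) (u v : dirlim) : c *: (u * v) = u * (c *: v).
Proof.
rewrite /GRing.scale /GRing.mul /=; move: u v; apply: dl_ind2 => i x y.
by rewrite !dl_E scalerAr.
Qed.
HB.instance Definition _ := GRing.Lalgebra_isAlgebra.Build F dirlim dl_scaleAr.

Section In.
Variable i : I.
Lemma dl_in_linear : linear (@dl_in i).
Proof. by move=> c x y; rewrite -dl_addE -dl_scaleE. Qed.
HB.instance Definition _ :=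
  GRing.isLinear.Build F (A i) dirlim *:%R (@dl_in i) dl_in_linear.
Lemma dl_in_monoid : monoid_morphism (@dl_in i).
Proof. by split; [rewrite -dl_oneE | move=> x y; rewrite -dl_mulE]. Qed.
HB.instance Definition _ :=
  GRing.isMonoidMorphism.Build (A i) dirlim (@dl_in i) dl_in_monoid.
End In.

(* Universal property: [dirlim], with the maps [dl_in], is the colimit. *)
Lemma dirlim_univ (B : algType F) (f : forall i, {lrmorphism A i -> B}) :
  (forall i j (h : le i j) x, f j (ds_map h x) = f i x) ->
  exists2 g : {lrmorphism dirlim -> B},
    forall i (x : A i), g (dl_in x) = f i x &
    forall g' : {lrmorphism dirlim -> B},
      (forall i (x : A i), g' (dl_in x) = f i x) -> g' =1 g.
Proof.
move=> fC; pose g (u : dirlim) : B := f _ (tagged (repr u)).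
have gE i (x : A i) : g (dl_in x) = f i x.
  rewrite /g; move: (dl_repr (dl_in x)); set u := repr _.
  move=> /dl_inP[k [hi [hu e]]].
  by rewrite -(fC _ _ hu) -e fC.
have gL : linear g.
  by move=> c; apply: dl_ind2 => i x y; rewrite -linearP !gE linearP.
have gM : monoid_morphism g.
  split; first by rewrite [1](dl_oneE (ds_idx0 D)) gE rmorph1.
  by apply: dl_ind2 => i x y; rewrite -rmorphM !gE rmorphM.
pose lM := GRing.isLinear.Build F dirlim B *:%R g gL.
pose mM := GRing.isMonoidMorphism.Build dirlim B g gM.
pose G : {lrmorphism dirlim -> B} := HB.pack g lM mM.
exists G; first exact: gE.
by move=> g' H; apply: dl_ind1 => i x; rewrite H; exact/esym/gE.
Qed.

End DirLim.

(* Entry (i, j) of a (+) a (+) ... *)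
Definition blockdiag (R : pzRingType) m (a : 'M[R]_m.+1) (i j : nat) : R :=
  if (i %/ m.+1 == j %/ m.+1)%N then a (inord (i %% m.+1)) (inord (j %% m.+1))
  else 0.

Section BlockDiag.
Variables (R : pzRingType) (m : nat).
Implicit Types a b : 'M[R]_m.+1.

Lemma blockdiagE a q r (i j : 'I_m.+1) :
  blockdiag a (q * m.+1 + i) (r * m.+1 + j) = if q == r then a i j else 0.
Proof.
rewrite /blockdiag !divnMDl // !divn_small // !addn0 !modnMDl !modn_small //.
by rewrite !inord_val.
Qed.

Lemma blockdiag_linear c a b i j :
  blockdiag (c *: a + b) i j = c * blockdiag a i j + blockdiag b i j.
Proof. by rewrite /blockdiag; case: ifP => _; rewrite ?mxE // mulr0 addr0. Qed.

Lemma blockdiag1 i j : blockdiag (1 : 'M[R]_m.+1) i j = (i == j)%:R.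
Proof.
rewrite /blockdiag [in RHS](divn_eq i m.+1) [in RHS](divn_eq j m.+1).
case: eqP => [->|ne].
  by rewrite mxE eqn_add2l -val_eqE /= !inordK ?ltn_pmod.
rewrite (_ : _ == _ = false) //; apply/eqP => e; apply: ne.
by move/(congr1 (fun k => k %/ m.+1)%N): e; rewrite -!divn_eq.
Qed.

Lemma blockdiag_mul a b N i j : (i < N * m.+1)%N ->
  \sum_(k < N * m.+1) blockdiag a i k * blockdiag b k j
  = blockdiag (a * b) i j.
Proof.
move=> iN; have qN : (i %/ m.+1 < N)%N by rewrite ltn_divLR.
pose G k := blockdiag a i k * blockdiag b k j.
have -> : \sum_(k < N * m.+1) G k
        = \sum_(q < N) \sum_(t < m.+1) G (q * m.+1 + t)%N.
  rewrite -(big_mkord xpredT G) big_nat_mul big_mkord; apply: eq_bigr => q _.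
  rewrite -{1}[(q * _)%N]add0n big_addn mulSn addnK big_mkord.
  by apply: eq_bigr => t _; rewrite addnC.
rewrite (bigD1 (Ordinal qN)) //= [X in _ + X]big1 ?addr0; last first.
  move=> q ne; apply: big1 => t _; rewrite /G {1}/blockdiag.
  have {}ne : (i %/ m.+1 == q)%N = false.
    by apply/negbTE; apply: contraNneq ne => e; apply/eqP/val_inj.
  by rewrite divnMDl // (divn_small (ltn_ord t)) addn0 ne mul0r.
rewrite /G /blockdiag; under eq_bigr => t _.
  rewrite divnMDl // (divn_small (ltn_ord t)) addn0 modnMDl.
  rewrite (modn_small (ltn_ord t)) inord_val eqxx.
  over.
by case: eqP => _; [rewrite mxE | rewrite big1 // => t _; rewrite mulr0].
Qed.

End BlockDiag.

(* x |-> diag(x, ..., x), i.e. x (x) 1; a ring morphism only if m.+1 %| n.+1. *)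
Definition mxamp (R : pzRingType) m n (a : 'M[R]_m.+1) : 'M[R]_n.+1 :=
  \matrix_(i, j) blockdiag a i j.

Lemma blockdiag_amp (R : pzRingType) m n (a : 'M[R]_m.+1) i j :
  (m.+1 %| n.+1)%N -> blockdiag (mxamp n a) i j = blockdiag a i j.
Proof.
move=> h; rewrite {1}/blockdiag mxE !inordK ?ltn_pmod // /blockdiag.
rewrite !modn_dvdm //; have [c nE] := dvdnP h; rewrite nE.
rewrite -!modn_divl mulnC !divnMA.
case: ifP => /eqP e1; [case: ifP => /eqP e2|]; case: ifP => /eqP e3 //;
  exfalso.
- by apply: e3; rewrite (divn_eq (i %/ m.+1) c) e1 e2 -divn_eq.
- by apply: e2; rewrite e3.
- by apply: e1; rewrite e3.
Qed.

Section AmpMorphism.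
Variables (F : fieldType) (m n : nat) (h : (m.+1 %| n.+1)%N).

Lemma mxamp_linear : linear (@mxamp F m n).
Proof. by move=> c x y; apply/matrixP => i j; rewrite !mxE blockdiag_linear. Qed.

Lemma mxamp_monoid : monoid_morphism (@mxamp F m n).
Proof.
split; first by apply/matrixP => i j; rewrite !mxE blockdiag1.
move=> x y; apply/matrixP => i j; rewrite !mxE.
have [N nE] := dvdnP h.
have iN : (i < N * m.+1)%N by rewrite -nE.
rewrite -(blockdiag_mul x y j iN) -nE.
by apply: eq_bigr => k _; rewrite !mxE.
Qed.

Definition mxamp_lrmorphism : {lrmorphism 'M[F]_m.+1 -> 'M[F]_n.+1} :=
  HB.pack (@mxamp F m n)
    (GRing.isLinear.Build F 'M[F]_m.+1 'M[F]_n.+1 *:%R _ mxamp_linear)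
    (GRing.isMonoidMorphism.Build 'M[F]_m.+1 'M[F]_n.+1 _ mxamp_monoid).
End AmpMorphism.

(* [None] stands for the exponent oo. *)
Definition supernatural := {p : nat | prime p} -> option nat.

Definition supernat_divides (m : nat) (s : supernatural) : bool :=
  (0 < m)%N &&
  `[< forall p, if s p is Some e then (logn (val p) m <= e)%N else true >].

Definition natdivisor (s : supernatural) := {m : nat | supernat_divides m s}.

Section SupernaturalMatrix.
Variables (F : fieldType) (s : supernatural).
Implicit Types d e : natdivisor s.

Lemma natdivisor_gt0 d : (0 < val d)%N.
Proof. by case/andP: (valP d). Qed.

Lemma natdivisor_pred d : (val d).-1.+1 = val d.
Proof. exact/prednK/natdivisor_gt0. Qed.

Definition natdivisor_le : rel (natdivisor s) := fun d e => (val d %| val e)%N.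

Lemma natdivisor_refl : reflexive natdivisor_le.
Proof. by move=> d; apply: dvdnn. Qed.

Lemma natdivisor_trans : transitive natdivisor_le.
Proof. by move=> e d f; apply: dvdn_trans. Qed.

Lemma supernat_divides1 : supernat_divides 1 s.
Proof.
by apply/andP; split=> //; apply/asboolP => p; case: (s p); rewrite ?logn1.
Qed.

Definition natdivisor1 : natdivisor s :=
  exist (fun m => supernat_divides m s) _ supernat_divides1.

Lemma natdivisor_directed d e :
  exists k, natdivisor_le d k && natdivisor_le e k.
Proof.
have lcmP : supernat_divides (lcmn (val d) (val e)) s.
  have d0 := natdivisor_gt0 d; have e0 := natdivisor_gt0 e.
  rewrite /supernat_divides lcmn_gt0 d0 e0; apply/asboolP => p.
  have /andP[_ /asboolP/(_ p)] := valP d.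
  have /andP[_ /asboolP/(_ p)] := valP e.
  by case: (s p) => // a le_e le_d; rewrite logn_lcm // geq_max le_d le_e.
by exists (exist (fun m => supernat_divides m s) _ lcmP); rewrite /natdivisor_le /= dvdn_lcml dvdn_lcmr.
Qed.

(* The dimension is written [(val d).-1.+1], which equals [val d], because
   'M_n is canonically a (nonzero) algebra only when n is a successor. *)
Definition divisor_mx d : algType F := 'M[F]_((val d).-1.+1).

Lemma divisor_dvdn d e : natdivisor_le d e ->
  ((val d).-1.+1 %| (val e).-1.+1)%N.
Proof. by rewrite !natdivisor_pred. Qed.

Definition divisor_amp d e (h : natdivisor_le d e) :
    {lrmorphism divisor_mx d -> divisor_mx e} :=
  mxamp_lrmorphism F (divisor_dvdn h).

Lemma divisor_amp_id d (h : natdivisor_le d d) x : divisor_amp h x = x.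
Proof.
apply/matrixP => i j; rewrite mxE.
have := @blockdiagE _ _ (x : 'M[F]_((val d).-1.+1)) 0 0 i j.
by rewrite mul0n !add0n eqxx.
Qed.

Lemma divisor_amp_comp d e f (hde : natdivisor_le d e)
    (hef : natdivisor_le e f) (hdf : natdivisor_le d f) x :
  divisor_amp hef (divisor_amp hde x) = divisor_amp hdf x.
Proof.
by apply/matrixP => i j; rewrite !mxE blockdiag_amp // divisor_dvdn.
Qed.

Definition supernat_system : dirsys F :=
  DirSys natdivisor_refl natdivisor_trans natdivisor1
    natdivisor_directed divisor_amp_id divisor_amp_comp.

Definition supernat_mx := dirlim supernat_system.
HB.instance Definition _ := GRing.Algebra.on supernat_mx.

End SupernaturalMatrix.

Record rcfin_mx (F : fieldType) := RCFin {
  rcfin_entry :> nat -> nat -> F;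
  rcfin_row : forall i, finite_set [set j | rcfin_entry i j != 0];
  rcfin_col : forall j, finite_set [set i | rcfin_entry i j != 0]
}.

HB.instance Definition _ (F : fieldType) := gen_eqMixin (rcfin_mx F).
HB.instance Definition _ (F : fieldType) := gen_choiceMixin (rcfin_mx F).

Section RCFin.
Variable F : fieldType.
Implicit Types x y z : rcfin_mx F.
Local Open Scope classical_set_scope.

Lemma rcfin_ext x y : (forall i j, x i j = y i j) -> x = y.
Proof.
case: x y => [f fr fc] [g gr gc] /= fg.
have {}fg : f = g by apply/funext => i; apply/funext => j.
by subst g; congr RCFin; exact: Prop_irrelevance.
Qed.

Lemma finsupp_bound (f : nat -> F) : finite_set [set k | f k != 0] ->
  exists N, forall k, (N <= k)%N -> f k = 0.
Proof.
case/finite_seqP => r rE; exists (\max_(k <- r) k).+1 => k lek.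
apply/eqP/negPn/negP => fk.
have kr : k \in r by have : [set k | f k != 0] k by []; rewrite rE.
by move: lek; rewrite ltnNge (leq_bigmax_seq (F := id)).
Qed.

Lemma fsum_ord (f : nat -> F) N : (forall k, (N <= k)%N -> f k = 0) ->
  \sum_(k \in setT) f k = \sum_(k < N) f k.
Proof.
move=> fN; rewrite -(big_mkord xpredT f).
rewrite (@bigfs _ _ _ _ (index_iota 0 N) predT) ?iota_uniq //.
  by apply: eq_fsbigl; apply/seteqP; split.
by move=> k _; rewrite mem_index_iota /= -leqNgt => /fN.
Qed.

Definition rcfin_zero : rcfin_mx F.
Proof.
by exists (fun _ _ => 0) => i; rewrite (_ : [set _ | _] = set0) //;
  apply/seteqP; split=> j //=; rewrite eqxx.
Defined.

Definition rcfin_one : rcfin_mx F.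
Proof.
exists (fun i j => (i == j)%:R) => i.
  apply: (sub_finite_set _ (finite_set1 i)) => j /=.
  by case: (i =P j) => [->|_] //=; rewrite eqxx.
apply: (sub_finite_set _ (finite_set1 i)) => j /=.
by case: (j =P i) => [->|_] //=; rewrite eqxx.
Defined.

Definition rcfin_opp x : rcfin_mx F.
Proof.
exists (fun i j => - x i j) => i.
  by apply: (sub_finite_set _ (rcfin_row x i)) => j /=; rewrite oppr_eq0.
by apply: (sub_finite_set _ (rcfin_col x i)) => j /=; rewrite oppr_eq0.
Defined.

Lemma add_neq0 (a b : F) : a + b != 0 -> a != 0 \/ b != 0.
Proof.
case: (eqVneq a 0) => [->|]; last by left.
by rewrite add0r; right.
Qed.

Definition rcfin_add x y : rcfin_mx F.
Proof.
exists (fun i j => x i j + y i j) => i.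
  apply: sub_finite_set (_ : finite_set ([set j | x i j != 0] `|`
                                         [set j | y i j != 0])).
    by move=> j /add_neq0.
  by rewrite finite_setU; split; apply: rcfin_row.
apply: sub_finite_set (_ : finite_set ([set j | x j i != 0] `|`
                                       [set j | y j i != 0])).
  by move=> j /add_neq0.
by rewrite finite_setU; split; apply: rcfin_col.
Defined.

Definition rcfin_scale (c : F) x : rcfin_mx F.
Proof.
exists (fun i j => c * x i j) => i.
  apply: (sub_finite_set _ (rcfin_row x i)) => j /=.
  by rewrite mulf_eq0 negb_or => /andP[].
apply: (sub_finite_set _ (rcfin_col x i)) => j /=.
by rewrite mulf_eq0 negb_or => /andP[].
Defined.

Lemma fsum_neq0 (f : nat -> F) : \sum_(k \in setT) f k != 0 ->
  exists k, f k != 0.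
Proof.
move=> f0; apply: contrapT => H; move/eqP: f0; apply.
apply: fsbig1 => k _; apply/eqP/negPn/negP => fk; apply: H.
by exists k.
Qed.

(* [\sum_(k \in setT)] adds up the nonzero terms, here finitely many; it would
   be 0 by convention if there were infinitely many. *)
Definition rcfin_mul x y : rcfin_mx F.
Proof.
exists (fun i j => \sum_(k \in setT) x i k * y k j) => i.
  apply: sub_finite_set
    (_ : finite_set (\bigcup_(k in [set k | x i k != 0]) [set j | y k j != 0])).
    move=> j /fsum_neq0[k]; rewrite mulf_eq0 negb_or => /andP[xk yk].
    by exists k.
  by apply: bigcup_finite => [|k _]; apply: rcfin_row.
apply: sub_finite_set
  (_ : finite_set (\bigcup_(k in [set k | y k i != 0]) [set j | x j k != 0])).
  move=> j /fsum_neq0[k]; rewrite mulf_eq0 negb_or => /andP[xk yk].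
  by exists k.
by apply: bigcup_finite => [|k _]; apply: rcfin_col.
Defined.

Lemma rcfin_mul_row x i : exists N, forall y j,
  rcfin_mul x y i j = \sum_(k < N) x i k * y k j.
Proof.
have [N xN] := finsupp_bound (rcfin_row x i); exists N => y j.
by apply: fsum_ord => k /xN ->; rewrite mul0r.
Qed.

Lemma rcfin_mul_col y j : exists N, forall x i,
  rcfin_mul x y i j = \sum_(k < N) x i k * y k j.
Proof.
have [N yN] := finsupp_bound (rcfin_col y j); exists N => x i.
by apply: fsum_ord => k /yN ->; rewrite mulr0.
Qed.

Lemma rcfin_addA : associative rcfin_add.
Proof. by move=> x y z; apply: rcfin_ext => i j; apply: addrA. Qed.
Lemma rcfin_addC : commutative rcfin_add.
Proof. by move=> x y; apply: rcfin_ext => i j; apply: addrC. Qed.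
Lemma rcfin_add0 : left_id rcfin_zero rcfin_add.
Proof. by move=> x; apply: rcfin_ext => i j; apply: add0r. Qed.
Lemma rcfin_addN : left_inverse rcfin_zero rcfin_opp rcfin_add.
Proof. by move=> x; apply: rcfin_ext => i j; apply: addNr. Qed.
HB.instance Definition _ := GRing.isZmodule.Build (rcfin_mx F)
  rcfin_addA rcfin_addC rcfin_add0 rcfin_addN.

Lemma rcfin_mulA : associative rcfin_mul.
Proof.
move=> x y z; apply: rcfin_ext => i j.
have [N xE] := rcfin_mul_row x i; have [M zE] := rcfin_mul_col z j.
rewrite xE zE; under eq_bigr do rewrite zE mulr_sumr.
rewrite exchange_big; apply: eq_bigr => l _.
by rewrite xE mulr_suml; apply: eq_bigr => k _; rewrite mulrA.
Qed.

Lemma rcfin_mul1 : left_id rcfin_one rcfin_mul.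
Proof.
move=> x; apply: rcfin_ext => i j.
rewrite /= (@fsum_ord _ i.+1).
  rewrite (bigD1 ord_max) //= eqxx mul1r big1 ?addr0 // => k ne.
  by rewrite -val_eqE /= eq_sym in ne; rewrite (negbTE ne) mul0r.
by move=> k ik; rewrite ltn_eqF // mul0r.
Qed.

Lemma rcfin_mulr1 : right_id rcfin_one rcfin_mul.
Proof.
move=> x; apply: rcfin_ext => i j.
rewrite /= (@fsum_ord _ j.+1).
  rewrite (bigD1 ord_max) //= eqxx mulr1 big1 ?addr0 // => k ne.
  by rewrite -val_eqE /= in ne; rewrite (negbTE ne) mulr0.
by move=> k jk; rewrite gtn_eqF // mulr0.
Qed.

Lemma rcfin_mulDl : left_distributive rcfin_mul rcfin_add.
Proof.
move=> x y z; apply: rcfin_ext => i j; have [N E] := rcfin_mul_col z j.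
transitivity (rcfin_mul x z i j + rcfin_mul y z i j) => //.
by rewrite !E -big_split; apply: eq_bigr => k _; apply: mulrDl.
Qed.

Lemma rcfin_mulDr : right_distributive rcfin_mul rcfin_add.
Proof.
move=> x y z; apply: rcfin_ext => i j; have [N E] := rcfin_mul_row x i.
transitivity (rcfin_mul x y i j + rcfin_mul x z i j) => //.
by rewrite !E -big_split; apply: eq_bigr => k _; apply: mulrDr.
Qed.

Lemma rcfin_one_neq0 : rcfin_one != rcfin_zero.
Proof.
apply/eqP => /(congr1 (fun x : rcfin_mx F => x 0 0)) /= /eqP.
by rewrite oner_eq0.
Qed.
HB.instance Definition _ := GRing.Zmodule_isNzRing.Build (rcfin_mx F)
  rcfin_mulA rcfin_mul1 rcfin_mulr1 rcfin_mulDl rcfin_mulDr rcfin_one_neq0.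

Lemma rcfin_scaleA a b x :
  rcfin_scale a (rcfin_scale b x) = rcfin_scale (a * b) x.
Proof. by apply: rcfin_ext => i j; apply: mulrA. Qed.
Lemma rcfin_scale1 : left_id 1 rcfin_scale.
Proof. by move=> x; apply: rcfin_ext => i j; apply: mul1r. Qed.
Lemma rcfin_scaleDr : right_distributive rcfin_scale +%R.
Proof. by move=> c x y; apply: rcfin_ext => i j; apply: mulrDr. Qed.
Lemma rcfin_scaleDl x : {morph rcfin_scale^~ x : a b / a + b}.
Proof. by move=> a b; apply: rcfin_ext => i j; apply: mulrDl. Qed.
HB.instance Definition _ := GRing.Zmodule_isLmodule.Build F (rcfin_mx F)
  rcfin_scaleA rcfin_scale1 rcfin_scaleDr rcfin_scaleDl.

Lemma rcfin_scaleAl (c : F) x y : c *: (x * y) = (c *: x) * y.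
Proof.
apply: rcfin_ext => i j; have [N E] := rcfin_mul_col y j.
transitivity (c * rcfin_mul x y i j) => //; rewrite [RHS]E E mulr_sumr.
by apply: eq_bigr => k _; apply: mulrA.
Qed.
HB.instance Definition _ :=
  GRing.Lmodule_isLalgebra.Build F (rcfin_mx F) rcfin_scaleAl.

Lemma rcfin_scaleAr (c : F) x y : c *: (x * y) = x * (c *: y).
Proof.
apply: rcfin_ext => i j; have [N E] := rcfin_mul_row x i.
transitivity (c * rcfin_mul x y i j) => //; rewrite [RHS]E E mulr_sumr.
by apply: eq_bigr => k _; apply: mulrCA.
Qed.
HB.instance Definition _ :=
  GRing.Lalgebra_isAlgebra.Build F (rcfin_mx F) rcfin_scaleAr.

End RCFin.

Definition recurrent (F : fieldType) (s : supernatural) : {pred rcfin_mx F} :=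
  fun x => `[< exists (d : natdivisor s) (a : 'M[F]_((val d).-1.+1)),
                 forall i j, x i j = blockdiag a i j >].
Arguments recurrent : clear implicits.

(* Main.v *)
Require Import Defs.
From mathcomp Require Import all_boot all_order all_algebra.
From HB Require Import structures.
From mathcomp Require Import boolp classical_sets cardinality.

(** Sending [a] to [a (+) a (+) ...] is an injective algebra map out of each
    matrix algebra, and these maps agree along the transition maps
    [a |-> diag(a, ..., a)].  They therefore induce an algebra map on the direct
    limit; it is injective because any two elements of the limit come from a
    common level, and its image is the set of recurrent matrices, which is thus a
    subalgebra. *)

Set Implicit Arguments.
Unset Strict Implicit.
Unset Printing Implicit Defensive.

Section RecurrentMatrices.
Import GRing.Theory.
Local Open Scope ring_scope.
Local Open Scope classical_set_scope.

Section BlockDiagonal.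
Variables (F : fieldType) (m : nat).
Implicit Types a b : 'M[F]_m.+1.

Lemma blockdiag_supp a i j :
  blockdiag a i j != 0 -> (i %/ m.+1 = j %/ m.+1)%N.
Proof. by rewrite /blockdiag; case: ifP => [/eqP //|_]; rewrite eqxx. Qed.

(** Block [q] ends before [q.+1 * m.+1]. Each row and each column of a block diagonal matrix is
    supported in a single block, which gives both finiteness conditions below. *)
Lemma finite_set_divn q (A : set nat) :
  (forall k, A k -> (k %/ m.+1 = q)%N) -> finite_set A.
Proof.
move=> Aq; apply: (sub_finite_set _ (finite_II (q.+1 * m.+1))) => k /= /Aq kq.
by rewrite -ltn_divLR // kq.
Qed.

Definition rcfin_blockdiag a : rcfin_mx F.
Proof.
by exists (blockdiag a) => i; apply: (@finite_set_divn (i %/ m.+1)) => j /=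
  /blockdiag_supp.
Defined.

Lemma rcfin_blockdiag_linear : linear rcfin_blockdiag.
Proof.
by move=> c a b; apply: rcfin_ext => i j; apply: blockdiag_linear.
Qed.

Lemma rcfin_blockdiag_monoid : monoid_morphism rcfin_blockdiag.
Proof.
split=> [|a b]; apply: rcfin_ext => i j; first exact: blockdiag1.
(* Cut the infinite sum at the end of the block containing [i]: this is a multiple of [m.+1], as
   [blockdiag_mul] needs, and any later [k] lies in a later block, where row [i] of the left factor
   vanishes. *)
have iN : (i < (i %/ m.+1).+1 * m.+1)%N by rewrite -ltn_divLR.
rewrite [LHS]/= -(blockdiag_mul a b j iN); symmetry.
apply: fsum_ord => k; rewrite -leq_divRL // => lt_ik.
apply/eqP; rewrite mulf_eq0; apply/orP; left; apply: contraTT lt_ik.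
by move=> /blockdiag_supp <-; rewrite ltnn.
Qed.

Definition rcfin_blockdiag_lrmorphism : {lrmorphism 'M[F]_m.+1 -> rcfin_mx F} :=
  HB.pack rcfin_blockdiag
    (GRing.isLinear.Build F 'M[F]_m.+1 (rcfin_mx F) *:%R _
       rcfin_blockdiag_linear)
    (GRing.isMonoidMorphism.Build 'M[F]_m.+1 (rcfin_mx F) _
       rcfin_blockdiag_monoid).

Lemma rcfin_blockdiag_inj : injective rcfin_blockdiag.
Proof.
move=> a b eq_ab; apply/matrixP => i j.
(* The matrix is recovered from the first diagonal block, [q = r = 0]. *)
have entryE (c : 'M[F]_m.+1) : blockdiag c i j = c i j.
  by have := blockdiagE c 0 0 i j; rewrite mul0n !add0n eqxx.
have /= ab := congr1 (@rcfin_entry F) eq_ab.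
by rewrite -entryE ab entryE.
Qed.

End BlockDiagonal.

Lemma subalg_closed_image (R : pzRingType) (A B : lalgType R)
    (f : {lrmorphism A -> B}) (S : {pred B}) :
  (forall x, x \in S <-> exists y, f y = x) -> GRing.subalg_closed S.
Proof.
move=> SP; split; first by apply/SP; exists 1; rewrite rmorph1.
  move=> c x y /SP[u <-] /SP[v <-]; apply/SP; exists (c *: u + v).
  by rewrite linearP.
move=> x y /SP[u <-] /SP[v <-]; apply/SP; exists (u * v).
by rewrite rmorphM.
Qed.

Lemma supernat_mx_embedding (F : fieldType) (s : supernatural) :
  exists f : {lrmorphism supernat_mx F s -> rcfin_mx F},
    injective f /\ (forall x, x \in recurrent F s <-> exists y, f y = x).
Proof.
pose g (d : natdivisor s) := rcfin_blockdiag_lrmorphism F (val d).-1.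
have gC d e (h : natdivisor_le d e) x : g e (divisor_amp F h x) = g d x.
  (* Since [val d] divides [val e], regrouping the copies of [x] into larger blocks leaves the
     infinite matrix unchanged. *)
  by apply: rcfin_ext => i j; apply: blockdiag_amp; apply: divisor_dvdn.
have [f fE _] := @dirlim_univ F (supernat_system F s) _ g gC.
exists f; split.
  apply: dl_ind2 => d x y; rewrite !fE => eq_xy.
  by rewrite (@rcfin_blockdiag_inj F _ x y eq_xy).
move=> x; split.
  move=> /asboolP[d [a xE]].
  by exists (@dl_in F (supernat_system F s) d a); rewrite fE; apply: rcfin_ext.
(* The level [d] representing an element of the limit is the divisor that witnesses recurrence. *)
move=> [y <-{x}]; move: y; apply: dl_ind1 => d a.
by apply/asboolP; exists d, a => i j; rewrite fE.
Qed.

End RecurrentMatrices.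

Theorem corollary1p5 (F : fieldType) (n : supernatural) :
  GRing.subalg_closed (recurrent F n) /\
  exists f : {lrmorphism supernat_mx F n -> rcfin_mx F},
    injective f /\ (forall x, x \in recurrent F n <-> exists y, f y = x).
Proof.
have [f [f_inj f_im]] := supernat_mx_embedding F n.
by split; [exact: subalg_closed_image f_im | exists f].
Qed.
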